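(* The scheme $\alpha \rightarrow_{d} \mathop{\sim}\mathop{\sim}\alpha$ is not provable in the axiom system $\mathrm{C}$; that is, there is a formula $\alpha$ such that $\alpha \rightarrow_{d} \mathop{\sim}\mathop{\sim}\alpha$ is not a theorem of $\mathrm{C}$.
   Context: Formulas are built from a countably infinite set of propositional variables using the unary connective $\sim$ (negation) and the binary connectives $\vee$ (disjunction), $\rightarrow_{d}$ (discussive implication), $\wedge_{d}$ (discussive conjunction), all treated as primitive. $\sim$ binds more tightly than the binary connectives. The axiom system $\mathrm{C}$ has as its sole rule modus ponens for $\rightarrow_{d}$ (from $\alpha$ and $\alpha\rightarrow_{d}\beta$ infer $\beta$), and as axioms all instances (for arbitrary formulas $\alpha,\beta,\gamma$) of the following schemes: C1: $\alpha\rightarrow_{d}(\beta\rightarrow_{d}\alpha)$. C2: $(\alpha\rightarrow_{d}(\beta\rightarrow_{d}\gamma))\rightarrow_{d}((\alpha\rightarrow_{d}\beta)\rightarrow_{d}(\alpha\rightarrow_{d}\gamma))$. C3: $(\alpha\wedge_{d}\beta)\rightarrow_{d}\alpha$. C4: $(\alpha\wedge_{d}\beta)\rightarrow_{d}\beta$. C5: $\alpha\rightarrow_{d}(\beta\rightarrow_{d}(\alpha\wedge_{d}\beta))$. C6: $\alpha\rightarrow_{d}(\alpha\vee\beta)$. C7: $\beta\rightarrow_{d}(\alpha\vee\beta)$. C8: $(\alpha\rightarrow_{d}\gamma)\rightarrow_{d}((\beta\rightarrow_{d}\gamma)\rightarrow_{d}((\alpha\vee\beta)\rightarrow_{d}\gamma))$.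 C9: $\alpha\vee(\alpha\rightarrow_{d}\beta)$. C10: $\sim(\sim\alpha\wedge_{d}(\sim\sim\alpha\wedge_{d}\sim(\alpha\vee\sim\alpha)))$. C11: $\sim(\sim\alpha\wedge_{d}(\sim\beta\wedge_{d}\sim(\alpha\vee\beta)))\rightarrow_{d}\sim(\sim\alpha\wedge_{d}(\sim\beta\wedge_{d}(\sim\gamma\wedge_{d}\sim(\alpha\vee(\beta\vee\gamma)))))$. C12: $\sim(\sim\alpha\wedge_{d}(\sim\beta\wedge_{d}(\sim\gamma\wedge_{d}\sim(\alpha\vee(\beta\vee\gamma)))))\rightarrow_{d}\sim(\sim\alpha\wedge_{d}(\sim\gamma\wedge_{d}(\sim\beta\wedge_{d}\sim(\alpha\vee(\gamma\vee\beta)))))$. C13: $\sim(\sim\alpha\wedge_{d}(\sim\beta\wedge_{d}(\sim\gamma\wedge_{d}\sim(\alpha\vee(\beta\vee\gamma)))))\rightarrow_{d}((\alpha\vee(\beta\vee\sim\gamma))\rightarrow_{d}(\alpha\vee\beta))$. C14: $\sim(\sim\alpha\wedge_{d}\sim\beta)\rightarrow_{d}(\alpha\vee\beta)$. C15: $(\alpha\vee(\beta\vee\sim\beta))\rightarrow_{d}\sim(\sim\alpha\wedge_{d}\sim(\beta\vee\sim\beta))$. A theorem of $\mathrm{C}$ is a formula derivable from these axioms by finitely many applications of modus ponens. A scheme is said to be unprovable in $\mathrm{C}$ if at least one of its instances is not a theorem of $\mathrm{C}$. *)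

(* Defs.v *)
Inductive formula : Type :=
| Var (n : nat)
| Neg (a : formula)
| Or (a b : formula)
| DImp (a b : formula)
| DAnd (a b : formula).

Declare Scope disc_scope.
Delimit Scope disc_scope with disc.
Bind Scope disc_scope with formula.

Notation "∼ a" := (Neg a) (at level 35, right associativity) : disc_scope.
Notation "a ∧d b" := (DAnd a b) (at level 40, no associativity) : disc_scope.
Notation "a ∨ b" := (Or a b) (at level 50, no associativity) : disc_scope.
Notation "a →d b" := (DImp a b) (at level 55, no associativity) : disc_scope.

Inductive C_axiom : formula -> Prop :=
| C1 a b : C_axiom (a →d (b →d a))
| C2 a b c : C_axiom ((a →d (b →d c)) →d ((a →d b) →d (a →d c)))
| C3 a b : C_axiom ((a ∧d b) →d a)
| C4 a b : C_axiom ((a ∧d b) →d b)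
| C5 a b : C_axiom (a →d (b →d (a ∧d b)))
| C6 a b : C_axiom (a →d (a ∨ b))
| C7 a b : C_axiom (b →d (a ∨ b))
| C8 a b c : C_axiom ((a →d c) →d ((b →d c) →d ((a ∨ b) →d c)))
| C9 a b : C_axiom (a ∨ (a →d b))
| C10 a : C_axiom (∼(∼a ∧d (∼∼a ∧d ∼(a ∨ ∼a))))
| C11 a b c : C_axiom
    (∼(∼a ∧d (∼b ∧d ∼(a ∨ b))) →d
     ∼(∼a ∧d (∼b ∧d (∼c ∧d ∼(a ∨ (b ∨ c))))))
| C12 a b c : C_axiom
    (∼(∼a ∧d (∼b ∧d (∼c ∧d ∼(a ∨ (b ∨ c))))) →d
     ∼(∼a ∧d (∼c ∧d (∼b ∧d ∼(a ∨ (c ∨ b))))))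
| C13 a b c : C_axiom
    (∼(∼a ∧d (∼b ∧d (∼c ∧d ∼(a ∨ (b ∨ c))))) →d
     ((a ∨ (b ∨ ∼c)) →d (a ∨ b)))
| C14 a b : C_axiom (∼(∼a ∧d ∼b) →d (a ∨ b))
| C15 a b : C_axiom
    ((a ∨ (b ∨ ∼b)) →d ∼(∼a ∧d ∼(b ∨ ∼b))).

Inductive C_theorem : formula -> Prop :=
| C_ax a : C_axiom a -> C_theorem a
| C_mp a b : C_theorem a -> C_theorem (a →d b) -> C_theorem b.

(* Main.v *)
(** C1-C9 axiomatise positive classical logic, so any two-valued valuation that
    is classical on the positive connectives validates them, whatever value it
    gives to negated formulas; negation need not be truth-functional.  Writing
    [N x] for the value of [∼x], put [N (∼x) = not (N x)], and [N x = 1] for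
    every other [x] except the conjunctions occurring in C10-C15.  Excluded
    middle [x or N x] then holds, hence also [N (∼x) <= x], and on the
    exceptional conjunctions [N] can be taken to be the largest value allowed
    by C11-C14.  A true variable [p] has [N p = 1] and so [∼∼p] is false. *)

Require Import Defs.
From Stdlib Require Import Bool.

(* [eval f] is the pair of the values of [f] and of [∼f]: the latter depends on
   the syntactic shape of [f], not just on its value. The second and third
   special cases are the conjunctions of C10-C11 and of C11-C13; the disjuncts
   under [Or] are ignored, as a negated disjunction is always true. *)
Fixpoint eval (f : formula) : bool * bool :=
  match f with
  | Var _ => (true, true)
  | Neg a => (snd (eval a), negb (snd (eval a)))
  | Or a b => (fst (eval a) || fst (eval b), true)
  | DImp a b => (implb (fst (eval a)) (fst (eval b)), true)
  | DAnd x y =>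
      (fst (eval x) && fst (eval y),
       match x, y with
       | Neg a, Neg b => fst (eval a) || fst (eval b)
       | Neg a, DAnd (Neg b) (Neg (Or _ _)) =>
           fst (eval a) || (fst (eval b) && negb (snd (eval b)))
       | Neg a, DAnd (Neg b) (DAnd (Neg c) (Neg (Or _ _))) =>
           fst (eval a) ||
           (implb (snd (eval c)) (fst (eval b)) &&
            implb (snd (eval b)) (fst (eval c)))
       | _, _ => true
       end)
  end.

(** On the special conjunctions, a false conjunct [∼b] forces [b] true by excluded middle for [b],
    and this makes the negated conjunction true. *)
Lemma eval_excluded_middle (f : formula) :
  fst (eval f) || snd (eval f) = true.
Proof.
(* The special conjunctions need the hypothesis for [a], [b], [c] lying deeper than the immediate
   subformulas [x], [y]. *)
revert f; fix IH 1; intros [n | a | a b | a b | x y]; cbn.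
- reflexivity.
- apply orb_negb_r.
- apply orb_true_r.
- apply orb_true_r.
- destruct x as [ | a | | | ]; try apply orb_true_r.
  destruct y as [ | b | | | y z]; try apply orb_true_r.
  + generalize (IH a) (IH b); cbn.
    destruct (eval a) as [[] []], (eval b) as [[] []]; easy.
  + destruct y as [ | b | | | ]; try apply orb_true_r.
    destruct z as [ | z | | | z w]; try apply orb_true_r.
    * destruct z; try apply orb_true_r.
      generalize (IH a) (IH b); cbn.
      destruct (eval a) as [[] []], (eval b) as [[] []]; easy.
    * destruct z as [ | c | | | ]; try apply orb_true_r.
      destruct w as [ | w | | | ]; try apply orb_true_r.
      destruct w; try apply orb_true_r.
      generalize (IH a) (IH b) (IH c); cbn.
      destruct (eval a) as [[] []], (eval b) as [[] []],
        (eval c) as [[] []]; easy.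
Qed.

(** C10 evaluates to excluded middle for [a]. The third special case is symmetric in [b] and [c],
    giving C12; its first implication gives C13. In C14 and C15 both sides have the same value. *)
Lemma eval_axiom (f : formula) : C_axiom f -> fst (eval f) = true.
Proof.
intros [a b|a b c|a b|a b|a b|a b|a b|a b c|a b|a|a b c|a b c|a b c|a b|a b];
  cbn;
  try generalize (eval_excluded_middle a);
  try generalize (eval_excluded_middle b);
  try generalize (eval_excluded_middle c);
  try destruct (eval a) as [[] []];
  try destruct (eval b) as [[] []];
  try destruct (eval c) as [[] []]; easy.
Qed.

Lemma eval_theorem (f : formula) : C_theorem f -> fst (eval f) = true.
Proof.
induction 1 as [f Hf | a b _ IHa _ IHab].
- now apply eval_axiom.
- cbn in IHab; now rewrite IHa in IHab.
Qed.

Theorem proposition2p1 : exists a : formula, ~ C_theorem (a →d ∼∼a).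
Proof.
exists (Var 0); intros H.
discriminate (eval_theorem _ H).
Qed.
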